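(* Let $R$ be an arbitrary (not necessarily unital) ring, let $P$ and $Q$ be right $R$-modules, and let $T$ be a finitely generated right $R$-module with $\mathrm{sr}(\mathrm{End}_R(T)) = 1$. If $P \oplus T \precsim Q \oplus T$, then $P \precsim Q$.
   Context: For right $R$-modules $P,Q$ (no projectivity or countable generation assumed), write $P\precsim Q$ if for every finitely generated submodule $X$ of $P$ there are module homomorphisms $\phi\colon X\to Q$ and $\psi\colon Q\to P$ such that $\psi\circ\phi$ is the inclusion $X\hookrightarrow P$. When $R$ is not unital, right $R$-modules may be regarded as unital right modules over the Dorroh unitization $R^+=\mathbb{Z}\oplus R$, and ''finitely generated'' is understood accordingly. A unital ring $S$ has stable rank one, $\mathrm{sr}(S)=1$, if for all $a,b\in S$ with $Sa+Sb=S$ there is $y\in S$ with $S(a+yb)=S$; equivalently, for all $a,b,x\in S$ with $xa+b=1$ there is $y\in S$ such that $a+yb$ is invertible in $S$. $\mathrm{End}_R(T)$ is the unital ring of $R$-module endomorphisms of $T$, with composition as product. *)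

(* Defs.v *)
From HB Require Import structures.
From mathcomp Require Import all_boot all_order all_algebra.
From mathcomp Require Import boolp.
Set Implicit Arguments.
Unset Strict Implicit.
Unset Printing Implicit Defensive.
Import GRing.Theory.
Local Open Scope ring_scope.

HB.mixin Record Zmodule_isRng R of GRing.Zmodule R := {
  rngmul : R -> R -> R;
  rngmulA : associative rngmul;
  rngmulDl : left_distributive rngmul +%R;
  rngmulDr : right_distributive rngmul +%R
}.

#[short(type="rngType")]
HB.structure Definition Rng := { R of Zmodule_isRng R & GRing.Zmodule R }.

(* There is no unit axiom. When R has a unit, the unital R-modules are a special
   case: their submodules, homomorphisms and finite generating families over R
   are the same as those over R^+ below. *)
HB.mixin Record Zmodule_isRightModule (R : rngType) M of GRing.Zmodule M := {
  ract : M -> R -> M;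
  ractA : forall x r s, ract (ract x r) s = ract x (rngmul r s);
  ractDl : forall x y r, ract (x + y) r = ract x r + ract y r;
  ractDr : forall x r s, ract x (r + s) = ract x r + ract x s
}.

#[short(type="rightModType")]
HB.structure Definition RightModule (R : rngType) :=
  { M of Zmodule_isRightModule R M & GRing.Zmodule M }.

Section Dorroh.
Variable R : rngType.

Definition rngmulr (s r : R) : R := rngmul r s.
Fact rngmul_is_zmod_morphism (r : R) : zmod_morphism (rngmul r).
Proof.
move=> x y; apply/(addIr (rngmul r y)).
by rewrite -rngmulDr !subrK.
Qed.
HB.instance Definition _ (r : R) :=
  GRing.isZmodMorphism.Build R R (rngmul r) (rngmul_is_zmod_morphism r).
Fact rngmulr_is_zmod_morphism (s : R) : zmod_morphism (rngmulr s).
Proof.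
move=> x y; apply/(addIr (rngmulr s y)).
by rewrite /rngmulr -rngmulDl !subrK.
Qed.
HB.instance Definition _ (s : R) :=
  GRing.isZmodMorphism.Build R R (rngmulr s) (rngmulr_is_zmod_morphism s).

Lemma rngmulMzr (r s : R) (n : int) : rngmul r (s *~ n) = rngmul r s *~ n.
Proof. exact: raddfMz. Qed.
Lemma rngmulMzl (r s : R) (n : int) : rngmul (r *~ n) s = rngmul r s *~ n.
Proof. exact: (raddfMz (rngmulr s)). Qed.

(* The Dorroh unitization Z (+) R. *)
Definition dorroh : Type := (int * R)%type.
HB.instance Definition _ := GRing.Zmodule.on dorroh.

Definition dorroh1 : dorroh := (1, 0).
Definition dorroh_mul (a b : dorroh) : dorroh :=
  (a.1 * b.1, b.2 *~ a.1 + a.2 *~ b.1 + rngmul a.2 b.2).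

Fact dorroh_mulA : associative dorroh_mul.
Proof.
move=> [m r] [n s] [p t]; rewrite /dorroh_mul /=; congr pair; first by rewrite mulrA.
rewrite !(rngmulDl, rngmulDr) !(rngmulMzr, rngmulMzl) rngmulA !mulrzDl -!mulrzA.
rewrite (mulrC n m) (mulrC p m) !addrA.
by rewrite [LHS](ACl (1*2*4*6*3*5*7))%AC.
Qed.
Fact dorroh_mul1 : left_id dorroh1 dorroh_mul.
Proof.
move=> [m r]; rewrite /dorroh_mul /= mul1r mul0rz mulr1z addr0.
by rewrite -[rngmul 0 r]/(rngmulr r 0) raddf0 addr0.
Qed.
Fact dorroh_mulr1 : right_id dorroh1 dorroh_mul.
Proof.
by move=> [m r]; rewrite /dorroh_mul /= mulr1 mul0rz mulr1z add0r raddf0 addr0.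
Qed.
Fact dorroh_mulDl : left_distributive dorroh_mul +%R.
Proof.
move=> [m r] [n s] [p t]; rewrite /dorroh_mul /=.
congr pair; rewrite /= ?mulrDl //.
rewrite mulrzDr mulrzDl rngmulDl !addrA.
by rewrite [LHS](ACl (1*3*5*2*4*6))%AC.
Qed.
Fact dorroh_mulDr : right_distributive dorroh_mul +%R.
Proof.
move=> [m r] [n s] [p t]; rewrite /dorroh_mul /=.
congr pair; rewrite /= ?mulrDr //.
rewrite mulrzDr mulrzDl rngmulDr !addrA.
by rewrite [LHS](ACl (1*3*5*2*4*6))%AC.
Qed.
Fact dorroh1_neq0 : dorroh1 != 0.
Proof. by []. Qed.

HB.instance Definition _ := GRing.Zmodule_isNzRing.Build dorroh
  dorroh_mulA dorroh_mul1 dorroh_mulr1 dorroh_mulDl dorroh_mulDr dorroh1_neq0.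
End Dorroh.

Section RightModuleTheory.
Variables (R : rngType) (M : rightModType R).

Definition ractl (r : R) (x : M) : M := ract x r.
Fact ract_is_zmod_morphism (x : M) : zmod_morphism (ract x).
Proof.
move=> r s; apply/(addIr (ract x s)).
by rewrite -ractDr !subrK.
Qed.
HB.instance Definition _ (x : M) :=
  GRing.isZmodMorphism.Build R M (ract x) (ract_is_zmod_morphism x).
Fact ractl_is_zmod_morphism (r : R) : zmod_morphism (ractl r).
Proof.
move=> x y; apply/(addIr (ractl r y)).
by rewrite /ractl -ractDl !subrK.
Qed.
HB.instance Definition _ (r : R) :=
  GRing.isZmodMorphism.Build M M (ractl r) (ractl_is_zmod_morphism r).

Lemma ractMzr (x : M) (r : R) (n : int) : ract x (r *~ n) = ract x r *~ n.
Proof. exact: raddfMz. Qed.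
Lemma ractMzl (x : M) (r : R) (n : int) : ract (x *~ n) r = ract x r *~ n.
Proof. exact: (raddfMz (ractl r)). Qed.

(* A right R-module, regarded as a unital right R^+-module, that is, as a left
   module over the converse ring of R^+. *)
Definition dorroh_scale (a : (dorroh R)^c) (x : M) : M := x *~ a.1 + ract x a.2.

Fact dorroh_scaleA a b x :
  dorroh_scale a (dorroh_scale b x) = dorroh_scale (a * b) x.
Proof.
case: a b => [m r] [n s].
rewrite -[_ * _]/(dorroh_mul (n, s) (m, r)) /dorroh_scale /dorroh_mul /=.
rewrite mulrzDl ractDl !ractDr !(ractMzr, ractMzl) ractA -!mulrzA !addrA.
by rewrite [LHS](ACl (1*3*2*4))%AC.
Qed.
Fact dorroh_scale1 : left_id 1 dorroh_scale.
Proof.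
move=> x; rewrite -[1]/(dorroh1 R) /dorroh_scale /= mulr1z.
by rewrite raddf0 addr0.
Qed.
Fact dorroh_scaleDr : right_distributive dorroh_scale +%R.
Proof. by move=> a x y; rewrite /dorroh_scale mulrzDl ractDl addrACA. Qed.
Fact dorroh_scaleDl x : {morph dorroh_scale^~ x : a b / a + b}.
Proof. by move=> a b; rewrite /dorroh_scale mulrzDr ractDr addrACA. Qed.

HB.instance Definition _ := GRing.Zmodule_isLmodule.Build (dorroh R)^c M
  dorroh_scaleA dorroh_scale1 dorroh_scaleDr dorroh_scaleDl.

Lemma dorroh_scaleE (m : int) (r : R) (x : M) :
  ((m, r) : (dorroh R)^c) *: x = x *~ m + ract x r.
Proof. by []. Qed.

Lemma dorroh_scale_ract (r : R) (x : M) :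
  ((0, r) : (dorroh R)^c) *: x = ract x r.
Proof. by rewrite dorroh_scaleE mulr0z add0r. Qed.
End RightModuleTheory.

(* The R^+-linear maps between right R-modules are the additive maps that
   commute with the action of R. *)
Lemma dorroh_linearP (R : rngType) (M N : rightModType R) (f : M -> N) :
  linear f <->
  zmod_morphism f /\ (forall x r, f (ract x r) = ract (f x) r).
Proof.
split=> [lf | [af rf]].
  pose F : {linear M -> N} := HB.pack f (GRing.isLinear.Build _ _ _ _ f lf).
  split=> [x y | x r]; first exact: (raddfB F).
  by rewrite -!dorroh_scale_ract; exact: (linearZ_LR F).
pose F : {additive M -> N} := HB.pack f (GRing.isZmodMorphism.Build _ _ f af).
case=> m r x y; rewrite !dorroh_scaleE.
by rewrite -![f _]/(F _) !raddfD raddfMz /= rf.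
Qed.

Section Endomorphisms.
Variables (A : pzRingType) (M : lmodType A).

Definition endo : Type := {linear M -> M}.
HB.instance Definition _ := gen_eqMixin endo.
HB.instance Definition _ := gen_choiceMixin endo.

Definition endo_fun (f : endo) : M -> M := (f : {linear M -> M}).
Coercion endo_fun : endo >-> Funclass.

Lemma endoP (f g : endo) : f =1 g -> f = g.
Proof.
case: f g => [f cf] [g cg] /= /funext fg.
rewrite /endo_fun /= in fg; subst g; congr GRing.Linear.Pack.
case: cf cg => [a b] [a' b'].
by congr GRing.Linear.Class; [case: a a' => p [p'] | case: b b' => p [p']]; rewrite (Prop_irrelevance p p').
Qed.

Definition endo_zero : endo := (\0 : {linear M -> M}).
Definition endo_opp (f : endo) : endo := (\- (f : {linear M -> M}) : {linear M -> M}).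
Definition endo_add (f g : endo) : endo :=
  ((f : {linear M -> M}) \+ (g : {linear M -> M}) : {linear M -> M}).
Definition endo_one : endo := (idfun : {linear M -> M}).
Definition endo_mul (f g : endo) : endo :=
  ((f : {linear M -> M}) \o (g : {linear M -> M}) : {linear M -> M}).

Fact endo_addA : associative endo_add.
Proof. by move=> f g h; apply: endoP => x; exact: addrA. Qed.
Fact endo_addC : commutative endo_add.
Proof. by move=> f g; apply: endoP => x; exact: addrC. Qed.
Fact endo_add0 : left_id endo_zero endo_add.
Proof. by move=> f; apply: endoP => x; exact: add0r. Qed.
Fact endo_addN : left_inverse endo_zero endo_opp endo_add.
Proof. by move=> f; apply: endoP => x; exact: addNr. Qed.
HB.instance Definition _ :=
  GRing.isZmodule.Build endo endo_addA endo_addC endo_add0 endo_addN.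

Fact endo_mulA : associative endo_mul.
Proof. by move=> f g h; apply: endoP. Qed.
Fact endo_mul1 : left_id endo_one endo_mul.
Proof. by move=> f; apply: endoP. Qed.
Fact endo_mulr1 : right_id endo_one endo_mul.
Proof. by move=> f; apply: endoP. Qed.
Fact endo_mulDl : left_distributive endo_mul +%R.
Proof. by move=> f g h; apply: endoP. Qed.
Fact endo_mulDr : right_distributive endo_mul +%R.
Proof. by move=> f g h; apply: endoP => x; exact: (raddfD (f : {linear M -> M})). Qed.
HB.instance Definition _ := GRing.Zmodule_isPzRing.Build endo
  endo_mulA endo_mul1 endo_mulr1 endo_mulDl endo_mulDr.

Lemma endoDE (f g : endo) x : (f + g) x = f x + g x. Proof. by []. Qed.
Lemma endoME (f g : endo) x : (f * g) x = f (g x). Proof. by []. Qed.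
Lemma endo1E x : (1 : endo) x = x. Proof. by []. Qed.
Lemma endo0E x : (0 : endo) x = 0. Proof. by []. Qed.
End Endomorphisms.

(* S a + S b = S implies S (a + y b) = S for some y. *)
Definition stable_rank_one (S : pzRingType) : Prop :=
  forall a b : S, (forall s, exists u v, s = u * a + v * b) ->
  exists y, forall s, exists u, s = u * (a + y * b).

Definition finitely_generated (A : pzRingType) (M : lmodType A) : Prop :=
  exists (n : nat) (g : 'I_n -> M),
    forall x, exists c : 'I_n -> A, x = \sum_i c i *: g i.

(* The submodules of P are the types X : subLmodType S carried by the
   predicates S on P, with inclusion \val; classically (asbool), boolean
   predicates are arbitrary subsets. *)
Definition precsim (A : pzRingType) (P Q : lmodType A) : Prop :=
  forall (S : pred P) (X : subLmodType S), finitely_generated X ->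
  exists (phi : {linear X -> Q}) (psi : {linear Q -> P}),
    forall x : X, psi (phi x) = \val x.

(* Main.v *)
From HB Require Import structures.
Require Import Defs.
From mathcomp Require Import all_boot all_algebra.

(** Write an arrow [X * T -> Q * T] as a 2 by 2 matrix.  For a finitely generated
submodule [X] of [P], the module [X * T] is a finitely generated submodule of
[P * T], so its inclusion factors as [psi \o phi] through [Q * T].  The (T, T)
entry of [psi \o phi = incl] reads
  [psi_TT * phi_TT + psi_TQ * phi_QT = 1]  in [End T],
and stable rank one gives [y] such that [u = phi_TT + y * psi_TQ * phi_QT] is
invertible.  This [u] is the (T, T) entry of [E \o phi], where [E] is the
automorphism [(q, t) |-> (q, t + y (psi_TQ q))] of [Q * T], while
[psi \o E^-1] is a left inverse of [E \o phi] up to inclusion.  One Gaussian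
elimination step with the pivot [u] then removes [T]: each [x] in [X] is
completed by a unique [t x] in [T] for which [E (phi (x, t x))] has the form
[(phi' x, 0)], and the [P]-component of [psi \o E^-1] recovers [x] from
[phi' x].

Stable rank one is formulated by left ideals and directly yields a left inverse
of [u], whereas solving for [t x] uses a right inverse;
[stable_rank_one_dedekind_finite] turns the former into the latter.  The
argument works over any unital ring of scalars ([precsim_cancel]), in
particular over the converse of the Dorroh unitization. *)

Set Implicit Arguments.
Unset Strict Implicit.
Unset Printing Implicit Defensive.
Import GRing.Theory.
Local Open Scope ring_scope.

(** * Stable rank one *)

(** If [v * u = 1], then [v] and [1 - u * v] generate the unit left ideal, so
some [v + y * (1 - u * v)] has a left inverse [w].  As [1 - u * v] kills [u] on
the right, multiplying by [u] gives [w = u]; hence [u] has a right inverse. *)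
Lemma stable_rank_one_dedekind_finite (S : pzRingType) (u v : S) :
  stable_rank_one S -> v * u = 1 -> u * v = 1.
Proof.
move=> srS vu1.
have e0 : (1 - u * v) * u = 0 by rewrite mulrBl mul1r -mulrA vu1 mulr1 subrr.
have [s|y hy] := srS v (1 - u * v).
  by exists (s * u), s; rewrite mulrBr mulr1 mulrA addrC subrK.
have [w w1] := hy 1.
have wu : u = w.
  by rewrite -[LHS]mul1r w1 -mulrA mulrDl vu1 -mulrA e0 mulr0 addr0 mulr1.
have right_inv : u * (v + y * (1 - u * v)) = 1 by rewrite {1}wu -w1.
rewrite -[in LHS](mulr1 v) -[in LHS]right_inv.
by rewrite [v * _]mulrA vu1 mul1r.
Qed.

Lemma stable_rank_one_unit (S : pzRingType) (x a b : S) :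
  stable_rank_one S -> x * a + b = 1 ->
  exists y v, v * (a + y * b) = 1 /\ (a + y * b) * v = 1.
Proof.
move=> srS xab1.
have [s|y hy] := srS a b.
  by exists (s * x), s; rewrite -mulrA -mulrDr xab1 mulr1.
have [v v1] := hy 1.
by exists y, v; split=> //; apply: stable_rank_one_dedekind_finite.
Qed.

(** * Arrows into and out of products *)

Section Pairing.
Variables (A : pzRingType) (L M N : lmodType A).
Variables (f : {linear L -> M}) (g : {linear L -> N}).

Definition pairing (x : L) : M * N := (f x, g x).

Fact pairing_is_linear : linear pairing.
Proof. by move=> c x y; rewrite /pairing !linearP. Qed.

HB.instance Definition _ :=
  GRing.isLinear.Build A L (M * N)%type _ pairing pairing_is_linear.
End Pairing.

Lemma finitely_generated_prod (A : pzRingType) (M N : lmodType A) :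
  finitely_generated M -> finitely_generated N ->
  finitely_generated (M * N)%type.
Proof.
move=> [m [g genM]] [n [h genN]].
exists (m + n)%N, (fun k => match split k with
  inl i => pairing idfun \0 (g i) | inr j => pairing \0 idfun (h j) end).
move=> [x y]; have [c ->] := genM x; have [d ->] := genN y.
exists (fun k => match split k with inl i => c i | inr j => d j end).
have splitl i : split (lshift n i) = inl i :> 'I_m + 'I_n := unsplitK (inl i).
have splitr j : split (rshift m j) = inr j :> 'I_m + 'I_n := unsplitK (inr j).
rewrite big_split_ord /=.
under [X in _ = X + _]eq_bigr => i _ do rewrite splitl -linearZ.
under [X in _ = _ + X]eq_bigr => j _ do rewrite splitr -linearZ.
rewrite -!linear_sum /pairing /=.
by congr pair; rewrite /= ?addr0 ?add0r.
Qed.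

(** * The submodule [X * T] of [P * T] *)

(** The predicate is an index of the type so that [X * T], whose module
structure is that of a product, can carry the inclusion into [P * T]. *)
Definition prod_sub (A : pzRingType) (P T : lmodType A) (S : pred P)
  (X : subLmodType S) : Type := (X * T)%type.

Section ProdSub.
Variables (A : pzRingType) (P T : lmodType A) (S : pred P) (X : subLmodType S).

Definition fst_pred : pred (P * T)%type := fun z => S z.1.

Local Notation XT := (prod_sub T X).

HB.instance Definition _ := GRing.Lmodule.on XT.

Definition prod_sub_val (z : XT) : P * T := (\val z.1, z.2).
Definition prod_sub_Sub (z : P * T) (Sz : fst_pred z) : XT := (Sub z.1 Sz, z.2).

Fact prod_sub_rect (K : XT -> Type) :
  (forall z Sz, K (@prod_sub_Sub z Sz)) -> forall z, K z.
Proof. by move=> KSub [x t]; case/SubP: x => p Sp; exact: (KSub (p, t) Sp). Qed.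

Fact prod_sub_SubK z (Sz : fst_pred z) : prod_sub_val (prod_sub_Sub Sz) = z.
Proof. by case: z Sz => p t Sp; rewrite /prod_sub_val /= SubK. Qed.

HB.instance Definition _ :=
  isSub.Build (P * T)%type fst_pred XT prod_sub_rect prod_sub_SubK.

Fact prod_sub_valB : zmod_morphism (\val : XT -> (P * T)%type).
Proof. by move=> z w; rewrite /= /prod_sub_val /= raddfB. Qed.

HB.instance Definition _ :=
  GRing.isSubZmodule.Build (P * T)%type fst_pred XT prod_sub_valB.

Fact prod_sub_valZ : scalable (\val : XT -> (P * T)%type).
Proof. by move=> c z; rewrite /= /prod_sub_val /= linearZ. Qed.

HB.instance Definition _ :=
  GRing.isSubLmodule.Build A (P * T)%type fst_pred XT prod_sub_valZ.
End ProdSub.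

(** * Cancellation *)

(** The elimination step.  With [y] supplied by stable rank one and [v] inverse
to the pivot [u], let [defect (q, s) = s + y (psi_TQ q)].  Then
[defect (phi (0, t)) = u t], so subtracting [v (defect (phi (x, 0)))] from the
second coordinate of [(x, 0)] kills the defect of its image; an element [(q, s)]
without defect is determined by [q], namely [s = - y (psi_TQ q)]. *)
Lemma cancel_factorization (A : pzRingType) (P Q T X : lmodType A)
    (i : {linear X -> P})
    (phi : {linear (X * T)%type -> (Q * T)%type})
    (psi : {linear (Q * T)%type -> (P * T)%type}) :
  stable_rank_one (endo T) ->
  (forall x t, psi (phi (x, t)) = (i x, t)) ->
  exists (phi' : {linear X -> Q}) (psi' : {linear Q -> P}),
    forall x, psi' (phi' x) = i x.
Proof.
move=> srT psiphi.
pose psi_TQ : {linear Q -> T} := snd \o psi \o pairing idfun \0.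
pose psi_TT : {linear T -> T} := snd \o psi \o pairing \0 idfun.
pose phi_T : {linear T -> (Q * T)%type} := phi \o pairing \0 idfun.
pose phi_TT : {linear T -> T} := snd \o phi_T.
pose phi_QT : {linear T -> Q} := fst \o phi_T.
pose b : {linear T -> T} := psi_TQ \o phi_QT.
have xab1 : (psi_TT : endo T) * phi_TT + b = 1.
  apply: endoP => t; rewrite -[LHS]/(psi_TT (phi_TT t) + b t) /= /pairing /=.
  rewrite -[RHS]/(i 0, t).2 -psiphi.
  case: (phi (0, t)) => q s /=.
  have -> : (q, s) = (0, s) + (q, 0) by congr pair; rewrite /= ?addr0 ?add0r.
  by rewrite linearD.
have [y [v [_ uv1]]] := stable_rank_one_unit srT xab1.
pose yl : {linear T -> T} := y; pose vl : {linear T -> T} := v.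
pose defect : {linear (Q * T)%type -> T} := snd \+ (yl \o psi_TQ \o fst).
have defect_v t : defect (phi (0, vl t)) = t.
  by rewrite -[RHS](congr1 (fun f : endo T => f t) uv1).
pose t_ : {linear X -> T} :=
  \- (vl \o defect \o phi \o pairing idfun \0).
exists (fst \o phi \o pairing idfun t_).
exists (fst \o psi \o pairing idfun (\- (yl \o psi_TQ))) => x /=.
have defect0 : defect (phi (x, t_ x)) = 0.
  have -> : (x, t_ x) = (x, 0) - (0, vl (defect (phi (x, 0)))).
    by congr pair; rewrite /= ?subr0 ?sub0r.
  by rewrite !linearB defect_v subrr.
rewrite /pairing /=; have := psiphi x (t_ x).
case: (phi (x, t_ x)) defect0 => q s /= defect0.
have -> : s = - yl (psi_TQ q) by apply/eqP; rewrite -addr_eq0 defect0.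
by move=> ->.
Qed.

Lemma precsim_cancel (A : pzRingType) (P Q T : lmodType A) :
  finitely_generated T -> stable_rank_one (endo T) ->
  precsim (P * T)%type (Q * T)%type -> precsim P Q.
Proof.
move=> fgT srT PT_QT S X fgX.
have [phi [psi psiphi]] :=
  PT_QT _ (prod_sub T X) (finitely_generated_prod fgX fgT).
exact: (@cancel_factorization _ _ _ _ _ \val phi psi srT
  (fun x t => psiphi (x, t))).
Qed.

Theorem theorem5p1 (R : rngType) (P Q T : rightModType R)
    (fgT : finitely_generated T) (srT : stable_rank_one (endo T)) :
  precsim (P * T)%type (Q * T)%type -> precsim P Q.
Proof. exact: precsim_cancel. Qed.
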